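(* Let $p_\Delta>0$ and $p_{min}<p_{max}$ be real numbers such that $r=(p_{max}-p_{min})/p_\Delta$ is an integer, and consider the multiresolution priority queue algorithm with these parameters (routines as given in the context), $r$ being the number of resolution groups supported by the queue. Then, in every state reachable from BUILD by valid calls: (1) the worst-case complexity of the INSERT routine is $O(r)$; (2) the complexity of the INSERT routine becomes $O(1)$ if there is at least one element in each slot $1,\dots,r$; (3) the complexity of each of the PEEK, EXTRACTMIN and EXTRACT routines is $O(1)$. All implied constants are absolute (independent of the number of elements in the queue, of $r$, and of the parameters).
   Context: Complexity is measured in the unit-cost model: each pointer operation, array access, comparison, and arithmetic operation on priorities (including the floor operation) costs one unit. An element $e$ is a record with a real priority $e.prio$ and two pointers $e.next$, $e.prev$. Inserted elements are required to have priority in $[p_{min},p_{max})$. The data structure consists of (i) a circular doubly linked list of elements containing a distinguished element $q$, the sentinel, which is never removed, and (ii) a lookup table $qlt$, an array indexed by $0,1,\dots,r$, each entry of which is NULL or a pointer to an element of the list. The slot of an element $e$ is $\mathrm{QltSlot}(e)=\lfloor (e.prio-q.prio)/p_\Delta\rfloor$; elements other than the sentinel have slots in $\{1,\dots,r\}$. BUILD: set $q.next=q.prev=q$, $q.prio=p_{min}-p_\Delta$, $qlt[0]=q$, and $qlt[i]=$ NULL for $1\le i\le r$. INSERT($e$) (valid when $e$ is not currently in the list and $p_{min}\le e.prio<p_{max}$): let $s=\mathrm{QltSlot}(e)$ and let $s'$ be the largest index $s'\le s$ with $qlt[s']\ne$ NULL, found by a linear scan starting at $s$ and decrementing by one at each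 step. If $s'=s$, link $e$ into the list immediately before the element $qlt[s]$, leaving $qlt$ unchanged. If $s'<s$, link $e$ into the list immediately after the element $qlt[s']$, and then set $qlt[s]=e$. PEEK(): return $q.next$ if $q.next\ne q$, and NULL otherwise. EXTRACT($e$) (valid when $e$ is a non-sentinel element currently in the list): unlink $e$ from the list (set $e.prev.next=e.next$ and $e.next.prev=e.prev$). Then let $s=\mathrm{QltSlot}(e)$. If $qlt[s]\neq e$, do nothing more. Otherwise, if $\mathrm{QltSlot}(e.prev)=s$, set $qlt[s]=e.prev$; else set $qlt[s]=$ NULL. Return $e$. EXTRACTMIN() (valid when the queue is non-empty): let $e=$ PEEK(), perform EXTRACT($e$), and return $e$. *)

(* Defs.v *)
From mathcomp Require Import all_boot all_order all_algebra.
From mathcomp Require Import reals.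

Set Implicit Arguments.
Unset Strict Implicit.
Unset Printing Implicit Defensive.

Import Order.TTheory GRing.Theory Num.Theory.
Local Open Scope ring_scope.

(* Pointers to elements; [None] is NULL.  An element is identified with its
   address in [E], its fields being stored in the state. *)
Notation ptr E := (option E).

Record state (R : realType) (E : eqType) (r : nat) := State {
  e_prio : E -> R;
  e_next : E -> ptr E;
  e_prev : E -> ptr E;
  qlt  : {ffun 'I_r.+1 -> ptr E} }.

(* The instructions of the unit-cost machine, indexed by the type of their
   result. *)
Inductive instr (R : realType) (E : eqType) : Type -> Type :=
| GetPrio of ptr E : instr R E R
| GetNext of ptr E : instr R E (ptr E)
| GetPrev of ptr E : instr R E (ptr E)
| SetNext of ptr E & ptr E : instr R E unit
| SetPrev of ptr E & ptr E : instr R E unit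
| GetQlt of int : instr R E (ptr E)
| SetQlt of int & ptr E : instr R E unit
| PtrEq of ptr E & ptr E : instr R E bool
| IdxEq of int & int : instr R E bool
| IdxPred of int : instr R E int
| PrioSub of R & R : instr R E R
| PrioDiv of R & R : instr R E R
| PrioFloor of R : instr R E int.

Inductive prog (R : realType) (E : eqType) (A : Type) : Type :=
| Ret of A
| Fault
| Do (T : Type) of instr R E T & (T -> prog R E A).

Arguments GetPrio {R E}. Arguments GetNext {R E}. Arguments GetPrev {R E}.
Arguments SetNext {R E}. Arguments SetPrev {R E}.
Arguments GetQlt {R E}. Arguments SetQlt {R E}.
Arguments PtrEq {R E}. Arguments IdxEq {R E}. Arguments IdxPred {R E}.
Arguments PrioSub {R E}. Arguments PrioDiv {R E}. Arguments PrioFloor {R E}.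
Arguments Ret {R E A}. Arguments Fault {R E A}. Arguments Do {R E A T}.

Fixpoint bind (R : realType) (E : eqType) (A B : Type) (p : prog R E A)
    (k : A -> prog R E B) : prog R E B :=
  match p with
  | Ret a => k a
  | Fault => Fault
  | Do _ i f => Do i (fun x => bind (f x) k)
  end.

(* [let!] executes one instruction, [let*] calls a routine. *)
Notation "'let!' x := i 'in' k" := (Do i (fun x => k))
  (at level 200, x name, k at level 200).
Notation "'let*' x := p 'in' k" := (bind p (fun x => k))
  (at level 200, x name, k at level 200).

(* Bounds check of an array index. *)
Definition slot_index (r : nat) (i : int) : option 'I_r.+1 :=
  if i is Posz n then insub n else None.

Section Semantics.
Variables (R : realType) (E : eqType) (r : nat).
Implicit Type s : state R E r.

Definition set_next s x v :=
  State (e_prio s) [eta e_next s with x |-> v] (e_prev s) (qlt s).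
Definition set_prev s x v :=
  State (e_prio s) (e_next s) [eta e_prev s with x |-> v] (qlt s).
Definition set_qlt s (j : 'I_r.+1) v :=
  State (e_prio s) (e_next s) (e_prev s)
        [ffun k => if k == j then v else qlt s k].

(* [None] is a run-time error: dereferencing NULL, or an array access out of
   bounds. *)
Definition step T (i : instr R E T) s : option (T * state R E r) :=
  match i in instr _ _ T return option (T * state R E r) with
  | GetPrio p => if p is Some x then Some (e_prio s x, s) else None
  | GetNext p => if p is Some x then Some (e_next s x, s) else None
  | GetPrev p => if p is Some x then Some (e_prev s x, s) else None
  | SetNext p v => if p is Some x then Some (tt, set_next s x v) else None
  | SetPrev p v => if p is Some x then Some (tt, set_prev s x v) else None
  | GetQlt i => if slot_index r i is Some j then Some (qlt s j, s) else None
  | SetQlt i v =>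
      if slot_index r i is Some j then Some (tt, set_qlt s j v) else None
  | PtrEq p p' => Some (p == p', s)
  | IdxEq i j => Some (i == j, s)
  | IdxPred i => Some (i - 1, s)
  | PrioSub x y => Some (x - y, s)
  | PrioDiv x y => Some (x / y, s)
  | PrioFloor x => Some (Num.floor x, s)
  end.

(* Result, final state and cost: every executed instruction costs one unit. *)
Fixpoint run A (p : prog R E A) s : option (A * state R E r * nat) :=
  match p with
  | Ret a => Some (a, s, 0%N)
  | Fault => None
  | Do _ i k =>
      if step i s is Some (x, s1) then
        if run (k x) s1 is Some (a, s2, c) then Some (a, s2, c.+1) else None
      else None
  end.

(* The cost is bounded only for executions that terminate without error. *)
Definition runs_within A (p : prog R E A) s (n : nat) : Prop :=
  exists (a : A) (s' : state R E r) (c : nat),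
    run p s = Some (a, s', c) /\ (c <= n)%N.

End Semantics.

Section Queue.
Variables (R : realType) (E : eqType) (r : nat).
Variables (q : E) (pmin pmax pdelta : R).
Implicit Type s : state R E r.

Definition build s : state R E r :=
  State [eta e_prio s with q |-> pmin - pdelta]
        [eta e_next s with q |-> Some q]
        [eta e_prev s with q |-> Some q]
        [ffun i => if i == ord0 then Some q else None].

Definition QltSlot (e : ptr E) : prog R E int :=
  let! x := GetPrio e in
  let! y := GetPrio (Some q) in
  let! d := PrioSub x y in
  let! z := PrioDiv d pdelta in
  let! i := PrioFloor z in
  Ret i.

Definition link_before (e x : ptr E) : prog R E unit :=
  let! p := GetPrev x in
  let! _ := SetNext e x in
  let! _ := SetPrev e p in
  let! _ := SetNext p e in
  let! _ := SetPrev x e in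
  Ret tt.

Definition link_after (e x : ptr E) : prog R E unit :=
  let! n := GetNext x in
  let! _ := SetNext e n in
  let! _ := SetPrev e x in
  let! _ := SetPrev n e in
  let! _ := SetNext x e in
  Ret tt.

Fixpoint scan_loop (fuel : nat) (i : int) : prog R E int :=
  if fuel is fuel'.+1 then
    let! x := GetQlt i in
    let! null := PtrEq x None in
    if null then let! i' := IdxPred i in scan_loop fuel' i' else Ret i
  else Fault.

(* With [r.+1] rounds the bound on the number of rounds is harmless: the
   unbounded loop would next access an index outside 0, ..., r, an error too. *)
Definition scan (i : int) : prog R E int := scan_loop r.+1 i.

Definition INSERT (e : ptr E) : prog R E unit :=
  let* i := QltSlot e in
  let* i' := scan i in
  let! same := IdxEq i' i in
  let! x := GetQlt i' in
  if same then link_before e x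
  else
    let* _ := link_after e x in
    let! _ := SetQlt i e in
    Ret tt.

Definition PEEK : prog R E (ptr E) :=
  let! n := GetNext (Some q) in
  let! empty := PtrEq n (Some q) in
  Ret (if empty then None else n).

Definition EXTRACT (e : ptr E) : prog R E (ptr E) :=
  let! p := GetPrev e in
  let! n := GetNext e in
  let! _ := SetNext p n in
  let! _ := SetPrev n p in
  let* i := QltSlot e in
  let! x := GetQlt i in
  let! pointed := PtrEq x e in
  if pointed then
    let! p' := GetPrev e in
    let* j := QltSlot p' in
    let! same := IdxEq j i in
    let! _ := SetQlt i (if same then p' else None) in
    Ret e
  else Ret e.

Definition EXTRACTMIN : prog R E (ptr E) :=
  let* e := PEEK in
  EXTRACT e.

Definition in_list s (e : E) : Prop :=
  exists k : nat, iter k (obind (e_next s)) (Some q) = Some e.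

Definition slot s (e : E) : int :=
  Num.floor ((e_prio s e - e_prio s q) / pdelta).

Definition valid_insert s (e : E) : Prop :=
  ~ in_list s e /\ pmin <= e_prio s e < pmax.

Definition valid_extract s (e : E) : Prop := e <> q /\ in_list s e.

Definition valid_extractmin s : Prop := exists e : E, e <> q /\ in_list s e.

(* The initial contents of the memory, including the priorities of all the
   elements to be inserted later, are arbitrary. *)
Inductive reachable : state R E r -> Prop :=
| reach_build s : reachable (build s)
| reach_insert s e a s' c : reachable s -> valid_insert s e ->
    run (INSERT (Some e)) s = Some (a, s', c) -> reachable s'
| reach_peek s a s' c : reachable s ->
    run PEEK s = Some (a, s', c) -> reachable s'
| reach_extract s e a s' c : reachable s -> valid_extract s e ->
    run (EXTRACT (Some e)) s = Some (a, s', c) -> reachable s'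
| reach_extractmin s a s' c : reachable s -> valid_extractmin s ->
    run EXTRACTMIN s = Some (a, s', c) -> reachable s'.

End Queue.

(* Main.v *)
Require Import Defs.
From mathcomp Require Import all_boot all_order all_algebra.
From mathcomp Require Import reals.
From mathcomp Require Import zify lra.
Local Open Scope ring_scope.

(** The reachable states satisfy the following invariant: the list is sorted by
    slot (with the sentinel first, in slot 0), and [qlt] maps each slot to the
    last element of the list in that slot.  In particular [qlt[0]] is the
    sentinel, which stops every scan after at most [r] steps, and a scan takes
    no step at all when the slot of the new element is occupied. *)

Set Implicit Arguments.
Unset Strict Implicit.
Unset Printing Implicit Defensive.

Import Order.TTheory GRing.Theory Num.Theory.

(** * Last elements of lists, paths, and the cost of a scan *)

Definition olast (T : Type) (l : seq T) : option T :=
  if l is x :: p then Some (last x p) else None.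

Lemma olast_cat_cons (T : Type) (l1 l2 : seq T) (x : T) :
  olast (l1 ++ x :: l2) = Some (last x l2).
Proof. by case: l1 => //= y l1; rewrite last_cat. Qed.

(** Edges of a path start in [belast x p] and end in [p]. The sharp domain matters: a splice changes
    [next] exactly at the last element of a segment. *)
Lemma sub_path_belast (T : eqType) (e e' : rel T) (x : T) (p : seq T) :
  {in belast x p & p, forall a b, e a b -> e' a b} -> path e x p -> path e' x p.
Proof.
elim: p x => //= y p IHp x ee' /andP[exy ep].
rewrite ee' ?mem_head //=; apply: IHp ep => a b a_p b_p.
by apply: ee'; rewrite inE ?a_p ?b_p orbT.
Qed.

Lemma run_bind (R : realType) (E : eqType) (r : nat) (A B : Type)
    (p : prog R E A) (k : A -> prog R E B) (s : state R E r) :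
  run (bind p k) s =
  if run p s is Some (a, s1, c) then
    if run (k a) s1 is Some (b, s2, c') then Some (b, s2, (c + c')%N) else None
  else None.
Proof.
elim: p s => [a|//|T i f IHf] s /=; first by case: run => [[[]]|].
case: step => [[x s1]|//]; rewrite IHf; case: run => [[[a s2] c]|//].
by case: run => [[[b s3] c']|].
Qed.

Lemma slot_index_nat (r n : nat) (le_nr : (n < r.+1)%N) :
  slot_index r n = Some (Ordinal le_nr).
Proof. by rewrite /slot_index insubT. Qed.

(** The non-NULL entry at index 0 stops the loop before it leaves the array. A NULL entry costs 3
    (read, test, decrement), the final one 2. That all skipped entries are NULL is what later
    locates the insertion point. *)
Lemma run_scan_loop (R : realType) (E : eqType) (r : nat) (s : state R E r)
    (fuel n : nat) :
  qlt s ord0 != None -> (n <= r)%N -> (n < fuel)%N ->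
  exists m : 'I_r.+1,
    [/\ (m <= n)%N, qlt s m != None,
        forall j : 'I_r.+1, (m < j <= n)%N -> qlt s j = None
      & run (scan_loop R E fuel n) s = Some (m%:Z, s, (2 + 3 * (n - m))%N)].
Proof.
move=> q0; elim: fuel n => // fuel IHfuel n le_nr lt_nf.
have lt_nr : (n < r.+1)%N by [].
cbn [scan_loop run step]; rewrite (slot_index_nat lt_nr).
case: eqP => [qn | /eqP qn]; last first.
  exists (Ordinal lt_nr); split=> //= [j|]; first by lia.
  by rewrite subnn.
case: n => [|n] in le_nr lt_nf lt_nr qn *.
  by case/eqP: q0; rewrite -qn; congr (qlt s _); apply: val_inj.
have [||m [le_mn qm qj runm]] := IHfuel n; [lia|lia|].
exists m; split=> //; first by lia.
  move=> j /andP[lt_mj]; rewrite leq_eqVlt => /predU1P[jn|lt_jn].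
    by rewrite -qn; congr (qlt s _); apply: val_inj.
  by apply: qj; rewrite lt_mj.
cbn [run step]; rewrite (_ : n.+1%:Z - 1 = n%:Z); last by lia.
by rewrite runm; congr (Some (_, _, _)); lia.
Qed.

(** * Splicing circular doubly linked lists *)

Section Links.
Variables (R : realType) (E : eqType) (r : nat).
Implicit Types (s : state R E r) (l : seq E).

Definition linked s : rel E :=
  [rel x y | (e_next s x == Some y) && (e_prev s y == Some x)].

(** On each field, the updates are nested in the order in which both [link_before] and [link_after]
    perform them, so either routine yields this state by computation. *)
Definition insert_between (a e b : E) s : state R E r :=
  State (e_prio s)
    [eta [eta e_next s with e |-> Some b] with a |-> Some e]
    [eta [eta e_prev s with e |-> Some a] with b |-> Some e]
    (qlt s).

Definition bridge (a b : E) s : state R E r :=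
  State (e_prio s) [eta e_next s with a |-> Some b]
    [eta e_prev s with b |-> Some a] (qlt s).

Lemma path_linked_frame s s' x l :
  {in belast x l, e_next s' =1 e_next s} -> {in l, e_prev s' =1 e_prev s} ->
  path (linked s) x l -> path (linked s') x l.
Proof.
move=> en ep; apply: sub_path_belast => a b a_l b_l; rewrite /linked /=.
by rewrite en // ep.
Qed.

Lemma last_belastN (x : E) l : uniq (x :: l) -> last x l \notin belast x l.
Proof. by rewrite lastI rcons_uniq => /andP[]. Qed.

Lemma mem_head_rcons l x : head x l \in rcons l x.
Proof. by case: l => [|y l] /=; rewrite inE eqxx. Qed.

(** Cutting the circle isolates the one edge that a splice replaces. The default [q] of [last] and
    [head] makes the sentinel the neighbour when [l1] or [l2] is empty, so these cases need no
    separate treatment. *)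
Lemma cycle_linked_cat s q l1 l2 :
  cycle (linked s) (q :: l1 ++ l2) =
  [&& path (linked s) q l1, linked s (last q l1) (head q l2)
    & path (linked s) (head q l2) (behead (rcons l2 q))].
Proof. by rewrite /= rcons_cat cat_path; case: l2. Qed.

Lemma belast_behead_rcons q l : belast (head q l) (behead (rcons l q)) = l.
Proof. by case: l => //= x l; rewrite belast_rcons. Qed.

(** A splice writes [next] at [last q l1] and [prev] at [head q l2]. These four facts say that the
    paths on either side of the cut read neither field. *)
Lemma uniq_cat_cons_rcons q l1 l2 : uniq (q :: l1 ++ l2) ->
  [/\ last q l1 \notin belast q l1, last q l1 \notin l2,
      head q l2 \notin l1 & head q l2 \notin behead (rcons l2 q)].
Proof.
move=> /=; rewrite mem_cat negb_or cat_uniq.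
case/andP=> /andP[ql1 ql2] /and3P[u1 d12 u2].
split; first by apply: last_belastN; rewrite /= ql1.
- have := mem_last q l1; rewrite inE => /predU1P[->//|al1].
  by apply/negP=> al2; case/hasP: d12; exists (last q l1).
- case: l2 {ql2 u2} d12 => //= x l2; by rewrite negb_or => /andP[].
case: l2 {d12} ql2 u2 => //= x l2; rewrite inE negb_or mem_rcons inE eq_sym.
by case/andP=> /negPf-> _ /andP[].
Qed.

Lemma cycle_insert_between s q e l1 l2 :
    uniq (q :: l1 ++ l2) -> e \notin q :: l1 ++ l2 ->
    cycle (linked s) (q :: l1 ++ l2) ->
  cycle (linked (insert_between (last q l1) e (head q l2) s))
    (q :: l1 ++ e :: l2).
Proof.
move=> u; have [a1 a2 b1 b2] := uniq_cat_cons_rcons u.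
rewrite inE mem_cat !negb_or => /and3P[eq el1 el2].
set s' := insert_between _ _ _ _.
have ae : (e == last q l1) = false.
  apply/negP=> /eqP ae; have := mem_last q l1.
  by rewrite -ae inE (negPf eq) (negPf el1).
have be : (e == head q l2) = false.
  apply/negP=> /eqP be; have := mem_head_rcons l2 q.
  by rewrite -be mem_rcons inE (negPf eq) (negPf el2).
rewrite cycle_linked_cat => /and3P[p1 _ p2].
rewrite -cat_rcons cycle_linked_cat.
(* The new edge from [last q l1] to [e] holds by construction, which leaves only the old left path
   to transport. *)
have -> : path (linked s') q (rcons l1 e) = path (linked s') q l1.
  by rewrite rcons_path {2}/linked /= !eqxx be /= eqxx andbT.
rewrite last_rcons; have -> /= : linked s' e (head q l2).
  by rewrite /linked /= !eqxx ae /= eqxx.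
apply/andP; split.
  apply: path_linked_frame p1 => x xl /=.
    case: eqP => [xa|_]; first by rewrite -xa xl in a1.
    case: eqP => // xe; have := mem_belast xl.
    by rewrite xe inE (negPf eq) (negPf el1).
  case: eqP => [xa|_]; first by rewrite -xa xl in b1.
  by case: eqP => // xe; rewrite -xe xl in el1.
apply: path_linked_frame p2 => x xl /=.
  rewrite belast_behead_rcons in xl.
  case: eqP => [xa|_]; first by rewrite -xa xl in a2.
  by case: eqP => // xe; rewrite -xe xl in el2.
case: eqP => [xa|_]; first by rewrite -xa xl in b2.
case: eqP => // xe; have := mem_behead xl.
by rewrite xe mem_rcons inE (negPf eq) (negPf el2).
Qed.

Lemma cycle_bridge s q e l1 l2 :
    uniq (q :: l1 ++ e :: l2) -> cycle (linked s) (q :: l1 ++ e :: l2) ->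
  cycle (linked (bridge (last q l1) (head q l2) s)) (q :: l1 ++ l2).
Proof.
move=> u.
have/uniq_cat_cons_rcons[a1 a2 b1 b2] : uniq (q :: l1 ++ l2).
  by apply: subseq_uniq u; rewrite /= eqxx cat_subseq // subseq_cons.
rewrite -cat_rcons.
rewrite !cycle_linked_cat rcons_path last_rcons => /and3P[/andP[p1 _] _ p2].
set s' := bridge _ _ _.
have -> /= : linked s' (last q l1) (head q l2) by rewrite /linked /= !eqxx.
apply/andP; split.
  apply: path_linked_frame p1 => x xl /=.
    by case: eqP => // xa; rewrite -xa xl in a1.
  by case: eqP => // xa; rewrite -xa xl in b1.
apply: path_linked_frame p2 => x xl /=.
  rewrite belast_behead_rcons in xl.
  by case: eqP => // xa; rewrite -xa xl in a2.
by case: eqP => // xa; rewrite -xa xl in b2.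
Qed.

(** Following [e_next] from [q] agrees with iterating [next] on the cyclic sequence, which never
    leaves it; conversely, the position of an element gives the number of steps. This turns the
    validity conditions on calls into list membership. *)
Lemma in_listP s q l : cycle (linked s) (q :: l) ->
  forall e, in_list q s e <-> e \in q :: l.
Proof.
have memk k : iter k (next (q :: l)) q \in q :: l.
  by elim: k => [|k IHk]; rewrite ?mem_head // iterS mem_next.
move=> cyc e; split=> [[k]|].
  suff -> : iter k (obind (e_next s)) (Some q) = Some (iter k (next (q :: l)) q).
    by case=> <-; apply: memk.
  elim: k => // k; rewrite !iterS => ->; apply/eqP.
  by have /andP[] := next_cycle cyc (memk k).
have {cyc memk} : path (linked s) q l by move: cyc; rewrite /= rcons_path => /andP[].
elim: l q => [|y l IHl] q /=; first by rewrite inE => _ /eqP->; exists 0%N.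
case/andP=> /andP[/eqP nq _] pl; rewrite inE => /predU1P[->|e_l].
  by exists 0%N.
by have [k ke] := IHl y pl e_l; exists k.+1; rewrite iterSr /= nq.
Qed.

End Links.

(** * The invariant and its preservation *)

Section Invariant.
Variables (R : realType) (E : eqType) (r : nat).
Variables (q : E) (pmin pmax pdelta : R).
Hypotheses (hdelta : 0 < pdelta) (hp : pmin < pmax).
Hypothesis hr : r%:R = (pmax - pmin) / pdelta.
Implicit Types (s : state R E r) (l : seq E).

Local Notation slot := (slot q pdelta).
Local Notation in_slot s i := [pred x | slot s x == i].

(** The list [l] omits the sentinel. Order is by slot only, not by priority, and [pairwise] is used
    because it splits along concatenations. On an empty slot [olast] gives [None], that is, NULL. *)
Record represents s l : Prop := Represents {
  rep_uniq : uniq (q :: l);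
  rep_cycle : cycle (linked s) (q :: l);
  rep_prio_q : e_prio s q = pmin - pdelta;
  rep_prio : forall x, x \in l -> pmin <= e_prio s x < pmax;
  rep_sorted : pairwise [rel x y | slot s x <= slot s y] (q :: l);
  rep_qlt : forall i : 'I_r.+1,
    qlt s i = olast (filter (in_slot s (nat_of_ord i)) (q :: l)) }.

Lemma r_gt0 : (0 < r)%N.
Proof. by rewrite -(ltr_nat R) hr divr_gt0 // subr_gt0. Qed.

Lemma slot_q s : slot s q = 0.
Proof. by rewrite /Defs.slot subrr mul0r floor0. Qed.

(** With the sentinel at [pmin - pdelta], the quotient to be floored is at least 1 and less than
    [(pmax - pmin) / pdelta + 1], which is [r + 1]. *)
Lemma slot_bounds s x : e_prio s q = pmin - pdelta ->
  pmin <= e_prio s x < pmax -> exists2 i : 'I_r.+1, slot s x = i%:Z & (0 < i)%N.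
Proof.
move=> prioq /andP[lo hi].
have ge1 : 1 <= slot s x.
  rewrite /Defs.slot floor_ge_int prioq ler_pdivlMr // mul1r; lra.
have ltr1 : slot s x < r.+1%:Z.
  rewrite /Defs.slot floor_lt_int prioq ltr_pdivrMr //.
  rewrite -[r.+1%:Z%:~R]/(r.+1%:R : R) -natr1 mulrDl hr divfK ?gt_eqF //; lra.
case: (slot s x) ge1 ltr1 => // n n0 nr.
by exists (Ordinal (nr : (n < r.+1)%N)).
Qed.

Lemma run_QltSlot s e :
  run (QltSlot q pdelta (Some e)) s = Some (slot s e, s, 5%N).
Proof. by []. Qed.

Lemma qlt_Some s l (i : 'I_r.+1) x : represents s l -> qlt s i = Some x ->
  x \in q :: l /\ slot s x = i%:Z.
Proof.
move=> rep; rewrite (rep_qlt rep).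
have : {subset filter (in_slot s (nat_of_ord i)) (q :: l) <=
        [pred y | (slot s y == i%:Z) && (y \in q :: l)]}.
  by move=> y; rewrite mem_filter.
case: filter => //= y k sub [<-].
by have /andP[/eqP-> ->] := sub _ (mem_last y k).
Qed.

Lemma qlt_None s l (i : 'I_r.+1) : represents s l -> qlt s i = None ->
  {in q :: l, forall x, slot s x != i%:Z}.
Proof.
move=> rep qi x x_l; apply/negP=> xi.
have : x \in filter (in_slot s (nat_of_ord i)) (q :: l).
  by rewrite mem_filter x_l andbT.
by move: qi; rewrite (rep_qlt rep); case: filter.
Qed.

Lemma qlt0 s l : represents s l -> qlt s ord0 != None.
Proof. by move=> rep; rewrite (rep_qlt rep) /= slot_q. Qed.

Lemma represents_build s : represents (build q pmin pdelta s) [::].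
Proof.
split=> //=; rewrite /linked /= ?eqxx //= => i.
by rewrite slot_q ffunE; case: i => -[|n] lt_n.
Qed.

(** The new table is a parameter, since one branch of [INSERT] keeps the old table and the other
    updates it. *)
Lemma represents_insert s l1 l2 e (qlt' : {ffun 'I_r.+1 -> ptr E}) :
    represents s (l1 ++ l2) -> e \notin q :: l1 ++ l2 ->
    pmin <= e_prio s e < pmax ->
    {in q :: l1, forall x, slot s x <= slot s e} ->
    {in l2, forall x, slot s e <= slot s x} ->
    (forall i : 'I_r.+1, qlt' i =
       olast (filter (in_slot s (nat_of_ord i)) (q :: l1 ++ e :: l2))) ->
  let s' := insert_between (last q l1) e (head q l2) s in
  represents (State (e_prio s') (e_next s') (e_prev s') qlt') (l1 ++ e :: l2).
Proof.
move=> rep e_l he le1 le2 hqlt' s'; have [u cyc prioq prio srt _] := rep.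
split=> //.
- by rewrite -cat_cons -[e :: l2]cat1s uniq_catCA cons_uniq e_l.
- exact: cycle_insert_between.
- move=> x; rewrite mem_cat inE orbCA -mem_cat => /predU1P[->//|].
  exact: prio.
(* Slots depend on priorities alone, so they are the same in both states by computation. *)
rewrite -[pairwise _ _]/(pairwise [rel x y | slot s x <= slot s y] _).
move: srt; rewrite -!cat_cons !pairwise_cat [pairwise _ (e :: _)]pairwise_cons.
case/and3P=> a12 -> ->; rewrite allrel_consr a12 !andbT.
by apply/andP; split; apply/allP.
Qed.

(** The new element goes just before the last element of its own slot, so every slot keeps its last
    element and the table stays correct. *)
Lemma represents_insert_before s l e x (i : 'I_r.+1) :
    represents s l -> e \notin q :: l -> pmin <= e_prio s e < pmax ->
    slot s e = i%:Z -> qlt s i = Some x ->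
  exists s' l', run (link_before R (Some e) (Some x)) s = Some (tt, s', 5%N) /\
    represents s' l'.
Proof.
move=> rep e_l he si qi; have [u cyc prioq prio srt hqlt] := rep.
have [x_l sx] := qlt_Some rep qi.
(* The sentinel has slot 0, whereas the slot of [e] is positive. *)
have xq : x != q.
  apply/eqP=> xq; have [j ej j0] := slot_bounds prioq he.
  by move: sx ej j0; rewrite si xq slot_q => <- [<-].
move: x_l; rewrite inE (negPf xq) /= => x_l.
case/splitPr: x_l => l1 l2 in rep e_l u cyc prio srt hqlt *.
have px : e_prev s x = Some (last q l1).
  by move: cyc; rewrite cycle_linked_cat => /and3P[_ /andP[_ /eqP]].
exists (insert_between (last q l1) e x s), (l1 ++ e :: x :: l2).
split; first by rewrite /= px.
apply: (represents_insert (l2 := x :: l2) (qlt' := qlt s)) => //.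
- move: srt; rewrite -cat_cons pairwise_cat allrel_consr => /and3P[/andP[/allP H _] _ _].
  by move=> y y_l; rewrite si -sx; apply: H.
- move: srt; rewrite -cat_cons pairwise_cat [pairwise _ (x :: _)]pairwise_cons.
  case/and4P=> _ _ /allP H _.
  move=> y; rewrite inE si -sx => /predU1P[->//|]; exact: H.
move=> j; rewrite hqlt -!cat_cons !filter_cat.
move: (filter _ (q :: l1)) => k1 /=; rewrite si sx.
by case: eqP => // _; rewrite !olast_cat_cons.
Qed.

(** Cut the list after [x], the last element of slot [m]. By sortedness and the emptiness of the
    slots [m + 1] to [i], everything up to [x] has slot at most [m] and everything after it has slot
    above [i]; hence [e] fits in between and is the last of slot [i]. *)
Lemma represents_insert_after s l e x (i m : 'I_r.+1) :
    represents s l -> e \notin q :: l -> pmin <= e_prio s e < pmax ->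
    slot s e = i%:Z -> (m < i)%N -> qlt s m = Some x ->
    (forall j : 'I_r.+1, (m < j <= i)%N -> qlt s j = None) ->
  exists s' l', run (link_after R (Some e) (Some x)) s = Some (tt, s', 5%N) /\
    represents (set_qlt s' i (Some e)) l'.
Proof.
move=> rep e_l he si lt_mi qm qN; have [u cyc prioq prio srt hqlt] := rep.
have [x_l sx] := qlt_Some rep qm.
have [l1 [l2 [ll lx]]] : exists l1 l2, l = l1 ++ l2 /\ last q l1 = x.
  move: x_l; rewrite inE => /predU1P[->|]; first by exists [::], l.
  by case/splitPr=> l1 l2; exists (rcons l1 x), l2; rewrite cat_rcons last_rcons.
rewrite {}ll in rep e_l u cyc prio srt hqlt.
have nx : e_next s x = Some (head q l2).
  by move: cyc; rewrite cycle_linked_cat lx => /and3P[_ /andP[/eqP]].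
have x_l1 : x \in q :: l1 by rewrite -lx mem_last.
move: srt; rewrite -cat_cons pairwise_cat => /and3P[a12 p1 _].
have le1 : {in q :: l1, forall y, slot s y <= m%:Z}.
  move=> y; rewrite -sx -lx.
  move: p1; rewrite lastI pairwise_rcons => /andP[/allP H _].
  by rewrite mem_rcons inE => /predU1P[->|/H].
have gt2 : {in l2, forall y, i%:Z < slot s y}.
  move=> y y_l2.
  have : m%:Z <= slot s y by rewrite -sx; apply: (allrelP a12).
  (* Otherwise the last element of slot [m], which is [x], would lie in [l2], although it already
     occurs in [q :: l1]. *)
  have mN : slot s y != m%:Z.
    apply/negP=> ym.
    have : y \in filter (in_slot s (nat_of_ord m)) l2 by rewrite mem_filter /= ym.
    move: qm; rewrite hqlt -cat_cons filter_cat.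
    have sub : {subset filter (in_slot s (nat_of_ord m)) l2 <= l2}.
      by move=> z; rewrite mem_filter => /andP[].
    case: filter sub => // z k sub; rewrite olast_cat_cons => -[zx] _.
    have x_l2 : x \in l2 by apply: sub; rewrite -zx mem_last.
    by move: u; rewrite -cat_cons cat_uniq => /and3P[_ /hasP[]]; exists x.
  rewrite le_eqVlt eq_sym (negPf mN) /=.
  have y_l : y \in q :: l1 ++ l2 by rewrite inE mem_cat y_l2 !orbT.
  case sy: (slot s y) => [n|//]; rewrite !ltz_nat => lt_mn.
  rewrite ltnNge; apply/negP=> le_ni.
  have lt_nr : (n < r.+1)%N := leq_ltn_trans le_ni (ltn_ord i).
  have qn : qlt s (Ordinal lt_nr) = None by apply: qN; rewrite /= lt_mn.
  by have := qlt_None rep qn y_l; rewrite sy eqxx.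
exists (insert_between x e (head q l2) s), (l1 ++ e :: l2).
split; first by rewrite /= nx.
rewrite -lx.
apply: represents_insert => //.
- by move=> y /le1 /le_trans; apply; rewrite si lez_nat ltnW.
- by move=> y /gt2 /ltW; rewrite si.
move=> j; rewrite ffunE hqlt -!cat_cons !filter_cat.
move: (filter _ (q :: l1)) => k1 /=; rewrite si.
rewrite eqz_nat -val_eqE eq_sym; case: eqP => // <-.
rewrite (_ : filter _ l2 = [::]) ?olast_cat_cons //.
apply/eqP; rewrite -(negbK (_ == _)) -has_filter; apply/hasPn=> y /gt2 /=.
by rewrite lt_neqAle eq_sym => /andP[].
Qed.

(** The cost is 14 if the slot is occupied: 5 for the slot, 2 for the scan, 2 for the test and the
    table read, 5 for linking. Otherwise it is [15 + 3 * (i - m)], with one more unit for the table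
    write. *)
Lemma run_INSERT s l e :
    represents s l -> e \notin q :: l -> pmin <= e_prio s e < pmax ->
  exists s' l' c, [/\ run (INSERT r q pdelta (Some e)) s = Some (tt, s', c),
    represents s' l', (c <= 18 * r)%N
    & forall x, x \in q :: l -> slot s x = slot s e -> (c <= 15)%N].
Proof.
move=> rep e_l he; have [i si i0] := slot_bounds (rep_prio_q rep) he.
have le_ir : (i <= r)%N by have := ltn_ord i.
have [m [le_mi qm qN runscan]] := run_scan_loop (qlt0 rep) le_ir (ltn_ord i).
(* Since [r] is positive, the constant 15 is absorbed into [15 * r]. *)
have c_r : (15 + 3 * (i - m) <= 18 * r)%N by have := r_gt0; lia.
case qmE: (qlt s m) qm => [x|//] _.
rewrite /INSERT run_bind run_QltSlot si run_bind /scan runscan.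
cbn [run step]; rewrite (slot_index_nat (ltn_ord m)) eqz_nat.
have -> : Ordinal (ltn_ord m) = m by apply: val_inj.
rewrite qmE; case: eqP => [mi|/eqP mi].
  have {}mi : m = i by apply: val_inj.
  rewrite mi in qmE *.
  have [s' [l' [-> rep']]] := represents_insert_before rep e_l he si qmE.
  exists s', l'; eexists; split=> //; first by have := r_gt0; rewrite subnn; lia.
  by rewrite subnn.
have lt_mi : (m < i)%N by rewrite ltn_neqAle mi.
have [s' [l' [run' rep']]] :=
  represents_insert_after rep e_l he si lt_mi qmE qN.
rewrite run_bind run'; cbn [run step]; rewrite (slot_index_nat (ltn_ord i)).
have -> : Ordinal (ltn_ord i) = i by apply: val_inj.
exists (set_qlt s' i (Some e)), l'; eexists; split=> //; first by lia.
(* In this branch the entry of slot [i] is NULL, so no listed element shares the slot of [e]. *)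
move=> x' x'_l sx'; have qi : qlt s i = None by apply: qN; rewrite lt_mi /=.
by have := qlt_None rep qi x'_l; rewrite sx' eqxx.
Qed.

Lemma represents_remove s l1 l2 e (qlt' : {ffun 'I_r.+1 -> ptr E}) :
    represents s (l1 ++ e :: l2) ->
    (forall i : 'I_r.+1, qlt' i =
       olast (filter (in_slot s (nat_of_ord i)) (q :: l1 ++ l2))) ->
  let s' := bridge (last q l1) (head q l2) s in
  represents (State (e_prio s') (e_next s') (e_prev s') qlt') (l1 ++ l2).
Proof.
move=> [u cyc prioq prio srt _] hqlt' s'.
have sub : subseq (l1 ++ l2) (l1 ++ e :: l2).
  by rewrite cat_subseq // subseq_cons.
have subq : subseq (q :: l1 ++ l2) (q :: l1 ++ e :: l2) by rewrite /= eqxx.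
split=> //.
- exact: subseq_uniq subq u.
- exact: cycle_bridge u cyc.
- by move=> x /(mem_subseq sub); apply: prio.
exact: subseq_pairwise subq srt.
Qed.

(** If [qlt[i]] is not [e], a later element is the last of slot [i] and stays so. If it is [e],
    sortedness leaves the predecessor as the only candidate for the new last element. The cost is 4
    for unlinking, 5 for the slot, 2 for the test, and at most 8 for the table update. *)
Lemma run_EXTRACT s l e : represents s l -> e \in l ->
  exists s' l' c, [/\ run (EXTRACT q pdelta (Some e)) s = Some (Some e, s', c),
    represents s' l' & (c <= 19)%N].
Proof.
move=> rep e_l; have [u cyc prioq prio srt hqlt] := rep.
have [i si i0] := slot_bounds prioq (prio _ e_l).
case/splitPr: e_l => l1 l2 in rep u cyc prio srt hqlt.
have pe : e_prev s e = Some (last q l1).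
  by move: cyc; rewrite cycle_linked_cat => /and3P[_ /andP[_ /eqP]].
have ne : e_next s e = Some (head q l2).
  move: cyc; rewrite -cat_rcons cycle_linked_cat last_rcons.
  by case/and3P=> _ /andP[/eqP].
(* Unlinking writes [prev] only at [head q l2], so the field [prev] of [e] can still be read
   afterwards. *)
have eb : (e == head q l2) = false.
  have [_ _ _] := uniq_cat_cons_rcons u.
  by apply: contraNF => /eqP->; exact: mem_head_rcons.
rewrite /EXTRACT; cbn [run step]; rewrite pe; cbn [run step].
rewrite ne; cbn [run step].
rewrite -[set_prev _ _ _]/(bridge (last q l1) (head q l2) s).
set s1 := bridge _ _ _.
have pe1 : e_prev s1 e = Some (last q l1) by rewrite /= eb.
rewrite run_bind run_QltSlot -[slot s1 e]/(slot s e) si.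
cbn [run step]; rewrite (slot_index_nat (ltn_ord i)).
have -> : Ordinal (ltn_ord i) = i by apply: val_inj.
rewrite -[qlt s1 i]/(qlt s i).
(* Removing [e] affects no slot other than its own. *)
have F j : j != i ->
    filter (in_slot s (nat_of_ord j)) (q :: l1 ++ e :: l2) =
    filter (in_slot s (nat_of_ord j)) (q :: l1 ++ l2).
  move=> ji; rewrite -!cat_cons !filter_cat; congr (_ ++ _).
  by rewrite /= si eqz_nat (inj_eq val_inj) eq_sym (negPf ji).
have qi : qlt s i = Some (last e (filter (in_slot s (nat_of_ord i)) l2)).
  rewrite hqlt -cat_cons filter_cat.
  move: (filter _ (q :: l1)) => k1 /=.
  by rewrite si eqxx olast_cat_cons.
case: eqP => qie; cbn [run step]; last first.
  exists s1, (l1 ++ l2); eexists; split=> //.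
  apply: (represents_remove (qlt' := qlt s) rep) => j.
  have [->|ji] := eqVneq j i; last by rewrite hqlt F.
  (* As the entry differs from [e], slot [i] has elements in [l2], and these determine its last
     element with or without [e]. *)
  move: qie; rewrite qi -cat_cons filter_cat.
  by case: (filter _ l2) => // y k _; rewrite olast_cat_cons.
rewrite pe1; cbn [run step].
rewrite run_bind run_QltSlot; cbn [run step].
rewrite (slot_index_nat (ltn_ord i)).
have -> : Ordinal (ltn_ord i) = i by apply: val_inj.
rewrite -[slot s1 _]/(slot s (last q l1)).
exists (set_qlt s1 i
  (if slot s (last q l1) == i%:Z then Some (last q l1) else None)).
exists (l1 ++ l2); eexists; split=> //.
apply: (represents_remove rep) => j; rewrite ffunE.
have [->|ji] := eqVneq j i; last by rewrite -F //; apply: hqlt.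
(* An element of slot [i] in [l2] would make the entry, here [e], a member of [l2], against
   uniqueness. *)
have -> : filter (in_slot s (nat_of_ord i)) (q :: l1 ++ l2) =
    filter (in_slot s (nat_of_ord i)) (q :: l1).
  rewrite -cat_cons filter_cat -[RHS]cats0; congr (_ ++ _).
  move: qie; rewrite qi.
  have : {subset filter (in_slot s (nat_of_ord i)) l2 <= l2}.
    by move=> z; rewrite mem_filter => /andP[].
  case: filter => // y k sub [ye]; have : e \in l2.
    by apply: sub; rewrite -ye mem_last.
  move: u; rewrite -cat_cons cat_uniq cons_uniq => /and4P[_ _ /negPf->] //.
rewrite lastI filter_rcons /=; case: ifP => [_|sl].
  by case: filter => //= z k; rewrite last_rcons.
(* Slots before the predecessor are at most its slot, which is at most [i]. An earlier element of
   slot [i] would thus force the predecessor into slot [i]. *)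
rewrite (_ : filter _ _ = [::]) //.
apply/eqP; rewrite -(negbK (_ == _)) -has_filter; apply/hasPn=> y y_l /=.
move: srt; rewrite -cat_cons pairwise_cat => /and3P[a12 p1 _].
have y_l1 := mem_belast y_l.
move: p1; rewrite lastI pairwise_rcons => /andP[/allP /(_ _ y_l) /= le_yl _].
have le_li : slot s (last q l1) <= i%:Z.
  by rewrite -si; apply: (allrelP a12); rewrite ?mem_last ?mem_head.
apply/negP=> /eqP syi; move/negP: sl; apply.
by rewrite eq_le le_li -syi.
Qed.

(** * The minimum, and all reachable states *)

Lemma run_PEEK s l : represents s l ->
  run (PEEK R q) s = Some (ohead l, s, 2%N).
Proof.
case=> u cyc _ _ _ _; rewrite /PEEK; cbn [run step].
have -> : e_next s q = Some (head q l).
  by move: cyc; rewrite (cycle_linked_cat s q [::]) => /and3P[_ /andP[/eqP]].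
case: l u {cyc} => [|x l] /=; first by rewrite eqxx.
rewrite inE negb_or => /andP[/andP[qx _] _].
by rewrite (inj_eq Some_inj) eq_sym (negPf qx).
Qed.

Lemma run_EXTRACTMIN s l e : represents s l -> e \in l ->
  exists a s' l' c, [/\ run (EXTRACTMIN q pdelta) s = Some (a, s', c),
    represents s' l' & (c <= 21)%N].
Proof.
case: l => // x l rep _.
have [s' [l' [c [runx rep' le_c]]]] := run_EXTRACT rep (mem_head x l).
exists (Some x), s', l', c.+2; split=> //.
by rewrite /EXTRACTMIN run_bind (run_PEEK rep) runx.
Qed.

Lemma in_list_rep s l e : represents s l -> in_list q s e <-> e \in q :: l.
Proof. by move=> rep; apply: in_listP; apply: rep_cycle rep. Qed.

Lemma valid_insert_rep s l e : represents s l -> valid_insert q pmin pmax s e ->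
  e \notin q :: l /\ pmin <= e_prio s e < pmax.
Proof. by move=> rep [/(in_list_rep e rep)/negP]. Qed.

Lemma valid_extract_rep s l e : represents s l -> valid_extract q s e -> e \in l.
Proof.
by move=> rep [/eqP eq /(in_list_rep e rep)]; rewrite inE (negPf eq).
Qed.

(** Execution is a function, so the final state of each call is the one provided by the lemma on its
    routine. *)
Lemma reachable_rep s : reachable q pmin pmax pdelta s -> exists l, represents s l.
Proof.
elim=> {s} [s|s e a s' c _ [l rep]|s a s' c _ [l rep]|s e a s' c _ [l rep]
           |s a s' c _ [l rep]].
- by exists [::]; apply: represents_build.
- case/(valid_insert_rep rep) => e_l he.
  by have [s1 [l1 [c1 [-> rep1 _ _]]]] := run_INSERT rep e_l he;
    case=> _ <- _; exists l1.
- by rewrite (run_PEEK rep) => -[_ <- _]; exists l.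
- move/(valid_extract_rep rep) => e_l.
  by have [s1 [l1 [c1 [-> rep1 _]]]] := run_EXTRACT rep e_l;
    case=> _ <- _; exists l1.
case=> e /(valid_extract_rep rep) e_l.
by have [a1 [s1 [l1 [c1 [-> rep1 _]]]]] := run_EXTRACTMIN rep e_l;
  case=> _ <- _; exists l1.
Qed.

End Invariant.

(** * The complexity bounds *)

Theorem lemma2 :
  exists cI cI' cP cM cE : nat,
  forall (R : realType) (E : eqType) (r : nat) (q : E)
    (pmin pmax pdelta : R) (hdelta : 0 < pdelta) (hp : pmin < pmax)
    (hr : r%:R = (pmax - pmin) / pdelta)
    (s : state R E r) (hs : reachable q pmin pmax pdelta s),
  (forall e : E, valid_insert q pmin pmax s e ->
     runs_within (INSERT r q pdelta (Some e)) s (cI * r)) /\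
  ((forall i : int, 1 <= i <= r%:Z ->
      exists e : E, in_list q s e /\ slot q pdelta s e = i) ->
   forall e : E, valid_insert q pmin pmax s e ->
     runs_within (INSERT r q pdelta (Some e)) s cI') /\
  runs_within (PEEK R q) s cP /\
  (valid_extractmin q s -> runs_within (EXTRACTMIN q pdelta) s cM) /\
  (forall e : E, valid_extract q s e ->
     runs_within (EXTRACT q pdelta (Some e)) s cE).
Proof.
(* The bound 21 is 2 for [PEEK] plus 19 for [EXTRACT]. *)
exists 18, 15, 2, 21, 19 => R E r q pmin pmax pdelta hdelta hp hr s hs.
have [l rep] := reachable_rep hdelta hp hr hs.
split; [|split; [|split; [|split]]].
- move=> e /(valid_insert_rep rep)[e_l he].
  have [s' [l' [c [runI _ le_c _]]]] := run_INSERT hdelta hp hr rep e_l he.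
  by exists tt, s', c.
- move=> full e /(valid_insert_rep rep)[e_l he].
  have [s' [l' [c [runI _ _ le_c]]]] := run_INSERT hdelta hp hr rep e_l he.
  exists tt, s', c; split=> //.
  have [i si i0] := slot_bounds hdelta hr (rep_prio_q rep) he.
  (* The slot of [e] lies between 1 and [r], so the hypothesis supplies a listed element [x] in it,
     and the constant bound applies. *)
  have [|x [/(in_list_rep _ rep) x_l sx]] := full i; first by have := ltn_ord i; lia.
  by apply: le_c x_l _; rewrite sx si.
- by exists (ohead l), s, 2%N; rewrite (run_PEEK rep).
- case=> e /(valid_extract_rep rep) e_l.
  have [a [s' [l' [c [runM _ le_c]]]]] := run_EXTRACTMIN hdelta hr rep e_l.
  by exists a, s', c.
- move=> e /(valid_extract_rep rep) e_l.
  have [s' [l' [c [runE _ le_c]]]] := run_EXTRACT hdelta hr rep e_l.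
  by exists (Some e), s', c.
Qed.
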